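(* Let $G$ be a finite group acting by ring automorphisms on a unital commutative ring $k$. Let $T=\{P_1,\ldots,P_m\}$ be a set of subgroups of $G$ of prime order containing exactly one subgroup from each conjugacy class of subgroups of $G$ of prime order. For $i=1,\ldots,m$ put $l_i=[G:P_i]$ and let $L_{P_i}$ be the set of all sets $\{g_1,\ldots,g_{l_i}\}\subseteq G$ such that $G=\bigcup_{j=1}^{l_i} g_jP_i$, with $G$ acting on $L_{P_i}$ by left multiplication. Let $X=\prod_{i=1}^m L_{P_i}$ with the diagonal $G$-action, let $w_1,\ldots,w_s$ be a set of representatives of the distinct $G$-orbits on $X$ (exactly one from each orbit), and write $$w_j=(\{g_{ij1},\ldots,g_{ijl_i}\})_{i=1}^m,\qquad j=1,\ldots,s.$$ Suppose that for each $i=1,\ldots,m$ the element $x_{P_i}\in k$ satisfies $tr_{P_i}(x_{P_i})=1$. Then the element $$x_G=\sum_{j=1}^s\Big[\prod_{i=1}^m\Big(\prod_{t=1}^{l_i} g_{ijt}(x_{P_i})\Big)\Big]$$ of $k$ satisfies $tr_G(x_G)=1$.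
   Context: For a subgroup $H$ of $G$, the trace map $tr_H:k\to k$ is defined by $tr_H(x)=\sum_{\sigma\in H}\sigma(x)$. For $g\in G$ and $x\in k$, $g(x)$ denotes the image of $x$ under the action of $g$. An element of $L_{P_i}$ is a complete set of representatives of the left cosets of $P_i$ in $G$; $g\in G$ sends $\{g_1,\ldots,g_{l_i}\}$ to $\{gg_1,\ldots,gg_{l_i}\}$. Empty products equal $1$. *)

(* Defs.v *)
From HB Require Import structures.
From mathcomp Require Import all_boot all_order all_algebra all_fingroup.

Set Implicit Arguments.
Unset Strict Implicit.
Unset Printing Implicit Defensive.

Import GRing.Theory.
Local Open Scope ring_scope.

(* A left action, whereas the library's [action] is a right action.  Each rho g
   with g in G is bijective, with inverse rho g^-1; rho is unconstrained
   outside G. *)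
Definition is_ring_action (gT : finGroupType) (G : {group gT})
    (k : comPzRingType) (rho : gT -> {rmorphism k -> k}) : Prop :=
  (forall x : k, rho 1%g x = x) /\
  (forall g h : gT, g \in G -> h \in G ->
     forall x : k, rho (g * h)%g x = rho g (rho h x)).

Definition tr (gT : finGroupType) (k : comPzRingType)
    (rho : gT -> {rmorphism k -> k}) (H : {group gT}) (x : k) : k :=
  \sum_(h in H) rho h x.

(* The family P is automatically injective: each P i is itself such a Q. *)
Definition prime_order_class_reps (gT : finGroupType) (G : {group gT})
    (m : nat) (P : 'I_m -> {group gT}) : Prop :=
  (forall i : 'I_m, P i \subset G /\ prime #|P i|) /\
  (forall Q : {group gT}, Q \subset G -> prime #|Q| ->
     exists! i : 'I_m, exists2 g : gT, g \in G & (P i :=: Q :^ g)%g).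

(* [g *: H] is the left coset gH. *)
Definition coset_rep_sets (gT : finGroupType) (G H : {group gT}) :
    {set {set gT}} :=
  [set A : {set gT} | [&& A \subset G, #|A| == #|G : H|%g
                        & \bigcup_(g in A) (g *: H)%g == G :> {set gT}]].

Definition prod_rep_sets (gT : finGroupType) (G : {group gT}) (m : nat)
    (P : 'I_m -> {group gT}) : {set {ffun 'I_m -> {set gT}}} :=
  [set v : {ffun 'I_m -> {set gT}} |
     [forall i : 'I_m, v i \in coset_rep_sets G (P i)]].

(* [g *: v i] is the set of all g * a for a in v i. *)
Definition diag_mul (gT : finGroupType) (m : nat) (g : gT)
    (v : {ffun 'I_m -> {set gT}}) : {ffun 'I_m -> {set gT}} :=
  [ffun i : 'I_m => (g *: v i)%g].

Definition diag_orbit (gT : finGroupType) (G : {group gT}) (m : nat)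
    (v : {ffun 'I_m -> {set gT}}) : {set {ffun 'I_m -> {set gT}}} :=
  [set diag_mul g v | g in G].

Definition orbit_reps (gT : finGroupType) (G : {group gT}) (m : nat)
    (X : {set {ffun 'I_m -> {set gT}}}) (s : nat)
    (w : 'I_s -> {ffun 'I_m -> {set gT}}) : Prop :=
  (forall j : 'I_s, w j \in X) /\
  (forall v : {ffun 'I_m -> {set gT}}, v \in X ->
     exists! j : 'I_s, v \in diag_orbit G (w j)).

(* Main.v *)
Require Import Defs.
From HB Require Import structures.
From mathcomp Require Import all_boot all_order all_algebra all_fingroup.
From mathcomp Require Import cyclic.

Set Implicit Arguments.
Unset Strict Implicit.
Unset Printing Implicit Defensive.

Import GRing.Theory.
Local Open Scope ring_scope.

(** The statement has two ingredients, one ring-theoretic and one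
    group-theoretic.

    For a single subgroup H of G with tr_H(x) = 1, apply each coset
    representative g to tr_H(x) = 1 and multiply the results over all left cosets:
    the product over the cosets C of the sums of g(x), g in C, is 1.  Expanding
    this product by distributivity amounts to choosing one element in each coset,
    so the sum over all sets A of coset representatives of the products of g(x),
    g in A, is 1 ([prod_sum_transversal], [sum_coset_reps]).  Multiplying these
    identities over the P_i and expanding once more gives
    [sum_prod_rep_sets]: the weights of the points of X sum to 1, where the
    weight of v is the product over i and over g in v_i of g(x_i).

    It remains to recognise tr_G(x_G) as this sum.  Weights are equivariant
    ([weight_diag_mul]), so tr_G(x_G) is the sum of the weights of all translates
    h w_j, and these run through X exactly once as soon as G acts freely on X
    ([sum_free_orbit_reps]).  Freeness ([prod_rep_sets_free]) is where the choice
    of the P_i matters: a nontrivial element fixing a point has a power of prime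
    order fixing it, which lies in a conjugate of some P_i, and such an element
    moves every set of representatives of the left cosets of P_i
    ([coset_rep_free]). *)

(** * Expanding a product of sums over the blocks of a partition *)

Lemma transversal_imset (T : finType) (Q : {set {set T}}) (D : {set T})
    (f : {set T} -> T) :
  partition Q D -> {in Q, forall B : {set T}, f B \in B} ->
  is_transversal (f @: Q) Q D.
Proof.
move=> partQ fQ; have [/eqP covQ trivQ _] := and3P partQ.
apply/and3P; split=> //.
  apply/subsetP=> _ /imsetP[B QB ->]; rewrite -covQ.
  by apply/bigcupP; exists B; rewrite ?fQ.
apply/forall_inP=> B QB; apply/cards1P; exists (f B); apply/setP=> t.
rewrite !inE; apply/andP/eqP=> [[/imsetP[C QC ->] fC_B] | ->].
  by rewrite -(def_pblock trivQ QB fC_B) (def_pblock trivQ QC (fQ C QC)).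
by rewrite imset_f ?fQ.
Qed.

(** Distributivity indexes the expansion by the functions picking an element of
    every block, and those functions are in bijection with the transversals.
    The point x0 is the junk value of such a function outside Q. *)
Lemma prod_sum_transversal (k : comPzSemiRingType) (T : finType) (x0 : T)
    (Q : {set {set T}}) (D : {set T}) (F : T -> k) :
  partition Q D ->
  \prod_(B in Q) \sum_(t in B) F t =
  \sum_(X : {set T} | is_transversal X Q D) \prod_(t in X) F t.
Proof.
move=> partQ; rewrite (big_distr_big_dep x0) /=.
pose choice (X : {set T}) :=
  [ffun B : {set T} => if B \in Q then transversal_repr x0 X B else x0].
pose section := pfamily x0 (mem Q) (fun B : {set T} => [in B]).
have sectionP (f : {ffun {set T} -> T}) :
    f \in section -> {in Q, forall B : {set T}, f B \in B}.
  by case/pfamilyP=> _ fQ B QB; apply: fQ.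
have imK (f : {ffun {set T} -> T}) : f \in section -> choice (f @: Q) = f.
  move=> fS; have trf := transversal_imset partQ (sectionP f fS).
  apply/ffunP=> B; rewrite ffunE; case: ifPn => [QB | nQB].
    apply/eqP; rewrite eq_sym -in_set1.
    by rewrite -(setI_transversal_pblock trf x0 QB) inE imset_f // (sectionP f fS).
  case/pfamilyP: fS => /subsetP supp_f _; apply/eqP; rewrite eq_sym.
  by apply: contraR nQB => fB; apply: supp_f.
rewrite (reindex_onto choice (fun f : {ffun {set T} -> T} => f @: Q)) /=; last first.
  by move=> f; apply: imK.
apply: eq_big => [X | X /andP[cS /eqP <-]].
  apply/andP/idP=> [[cS /eqP <-] | trX].
    exact: transversal_imset partQ (sectionP _ cS).
  split; last first.
    rewrite -[X in _ == X](im_transversal_repr trX x0); apply/eqP.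
    by apply: eq_in_imset => B QB; rewrite ffunE QB.
  apply/pfamilyP; split=> [|B QB].
    by apply/subsetP=> B; rewrite !inE ffunE; case: ifP => //; rewrite eqxx.
  by rewrite ffunE QB; apply: repr_mem_pblock trX x0 B QB.
rewrite (imK _ cS) big_imset //= => B C QB QC eqBC.
have [_ trivQ _] := and3P partQ.
rewrite -(def_pblock trivQ QB (sectionP _ cS B QB)) eqBC.
exact: def_pblock trivQ QC (sectionP _ cS C QC).
Qed.

(** * Sets of representatives of the left cosets of one subgroup *)

Section CosetRepresentatives.

Variables (gT : finGroupType) (G H : {group gT}).
Hypothesis sHG : H \subset G.

Lemma lcosets_partition : partition (lcosets H G) G.
Proof.
apply/and3P; split.
- apply/eqP/setP=> g; apply/bigcupP/idP=> [[_ /lcosetsP[a Ga ->]] | Gg].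
    by move=> /lcosetP[h Hh ->]; rewrite groupM // (subsetP sHG).
  by exists (g *: H)%g; [apply/lcosetsP; exists g | apply: lcoset_refl].
- apply/trivIsetP=> _ _ /lcosetsP[a _ ->] /lcosetsP[b _ ->].
  apply: contraR => /pred0Pn[g /andP[/= /lcoset_eqP <- /lcoset_eqP <-]] //.
- apply/negP=> /lcosetsP[a _ /esym aH0].
  by have := lcoset_refl H a; rewrite aH0 inE.
Qed.

Lemma coset_rep_imset (A : {set gT}) :
  A \in coset_rep_sets G H -> [set (a *: H)%g | a in A] = lcosets H G.
Proof.
rewrite inE => /and3P[sAG _ /eqP covA].
apply/setP=> C; apply/imsetP/lcosetsP=> [[a Aa ->] | [g Gg ->]].
  by exists a => //; apply: (subsetP sAG).
move: Gg; rewrite -[in X in X -> _]covA => /bigcupP[a Aa /lcoset_eqP eq_ga].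
by exists a.
Qed.

(** The covering condition makes the map to cosets surjective, and the condition
    on the cardinality then forces it to be injective. *)
Lemma coset_rep_inj (A : {set gT}) :
  A \in coset_rep_sets G H -> {in A &, injective (fun a => a *: H)%g}.
Proof.
move=> AL; apply/imset_injP; rewrite coset_rep_imset // card_lcosets.
by move: AL; rewrite inE => /and3P[_ /eqP-> _].
Qed.

(** This brings the sum over sets of representatives under the expansion of
    products over the blocks of a partition. *)
Lemma coset_rep_setsE (A : {set gT}) :
  (A \in coset_rep_sets G H) = is_transversal A (lcosets H G) G.
Proof.
apply/idP/idP=> [AL | trA].
  apply/and3P; split; first exact: lcosets_partition.
    by move: AL; rewrite inE => /andP[].
  apply/forall_inP=> C; rewrite -(coset_rep_imset AL) => /imsetP[a Aa ->].
  apply/cards1P; exists a; apply/setP=> b; rewrite !inE.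
  apply/andP/eqP=> [[Ab /lcoset_eqP eq_ba] | ->]; last by rewrite lcoset_refl.
  exact: (coset_rep_inj AL).
have sAG := transversal_sub trA.
rewrite inE sAG (card_transversal trA) card_lcosets eqxx /=.
apply/eqP/setP=> g; apply/bigcupP/idP=> [[a Aa /lcosetP[h Hh ->]] | Gg].
  by rewrite (groupM (subsetP sAG a Aa)) // (subsetP sHG).
have QgH : (g *: H)%g \in lcosets H G by apply/lcosetsP; exists g.
exists (transversal_repr 1%g A (g *: H)%g).
  exact: repr_mem_transversal trA _ _ QgH.
by rewrite lcoset_sym; apply: repr_mem_pblock trA _ _ QgH.
Qed.

Lemma lcoset_coset_rep (A : {set gT}) (g : gT) :
  g \in G -> A \in coset_rep_sets G H -> (g *: A)%g \in coset_rep_sets G H.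
Proof.
move=> Gg; rewrite !inE card_lcoset => /and3P[sAG -> /eqP covA].
apply/and3P; split=> //.
  by apply/subsetP=> _ /lcosetP[a Aa ->]; rewrite groupM // (subsetP sAG).
apply/eqP; rewrite -[RHS](lcoset_id Gg) -[in RHS]covA.
apply/setP=> y; rewrite mem_lcoset.
apply/bigcupP/bigcupP=> [[_ /lcosetP[a Aa ->]] | [a Aa]].
  by rewrite lcosetM mem_lcoset => ?; exists a.
by move=> agy; exists (g * a)%g; [rewrite mem_lcoset mulKg | rewrite lcosetM mem_lcoset].
Qed.

(** Such an h fixes the coset g^-1 H under left multiplication.  If it also
    fixes A, it maps the unique representative of that coset in A to itself, and
    left multiplication by a nontrivial element fixes nothing. *)
Lemma coset_rep_free (A : {set gT}) (g h : gT) :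
  A \in coset_rep_sets G H -> g \in G -> h \in (H :^ g)%g ->
  (h *: A)%g = A -> h = 1%g.
Proof.
move=> AL Gg; rewrite mem_conjg => Hh fixA.
have : (g^-1 *: H)%g \in lcosets H G by apply/lcosetsP; exists g^-1%g; rewrite ?groupV.
rewrite -(coset_rep_imset AL) => /imsetP[a Aa eq_ga].
suff /eqP: (h * a)%g = a by rewrite eq_mulgV1 mulgK => /eqP.
apply: (coset_rep_inj AL) => //; first by rewrite -fixA mem_lcoset mulKg.
rewrite lcosetM -eq_ga -lcosetM.
suff -> : (h * g^-1 = g^-1 * h ^ g^-1)%g by rewrite lcosetM lcoset_id.
by rewrite conjgE invgK !mulgA mulVg mul1g.
Qed.

(** The sum expands the product, over the cosets g H, of g(tr_H(x)) = g(1) = 1. *)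
Lemma sum_coset_reps (k : comPzRingType) (rho : gT -> {rmorphism k -> k})
    (x : k) :
  is_ring_action G rho -> tr rho H x = 1 ->
  \sum_(A in coset_rep_sets G H) \prod_(g in A) rho g x = 1.
Proof.
move=> [_ rhoM] trx.
rewrite (eq_bigl _ _ coset_rep_setsE) -(prod_sum_transversal 1%g) ?lcosets_partition //.
apply: big1 => _ /lcosetsP[g Gg ->].
rewrite -lcosetE big_imset /=; last by move=> ? ? _ _; apply: mulgI.
rewrite -[RHS](rmorph1 (rho g)) -trx rmorph_sum.
by apply: eq_bigr => h Hh; rewrite rhoM // (subsetP sHG).
Qed.

End CosetRepresentatives.

(** * The diagonal action on families of sets of representatives *)

Section Translation.

Variables (gT : finGroupType) (G : {group gT}) (m : nat).
Variable P : 'I_m -> {group gT}.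
Hypothesis sPG : forall i, P i \subset G.

Local Notation X := (prod_rep_sets G P).

Lemma diag_mulM (g h : gT) (v : {ffun 'I_m -> {set gT}}) :
  diag_mul (g * h)%g v = diag_mul g (diag_mul h v).
Proof. by apply/ffunP=> i; rewrite !ffunE lcosetM. Qed.

Lemma diag_mul1 (v : {ffun 'I_m -> {set gT}}) : diag_mul 1%g v = v.
Proof. by apply/ffunP=> i; rewrite ffunE lcoset1. Qed.

Lemma diag_mul_prod_rep_sets (g : gT) (v : {ffun 'I_m -> {set gT}}) :
  g \in G -> v \in X -> diag_mul g v \in X.
Proof.
move=> Gg; rewrite !inE => /forallP Xv; apply/forallP=> i.
by rewrite ffunE lcoset_coset_rep.
Qed.

(** The stabiliser of v, if nontrivial, contains an element h of prime order;
    some conjugate of h lies in a P_i, so h cannot fix the component v_i. *)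
Lemma prod_rep_sets_free (g : gT) (v : {ffun 'I_m -> {set gT}}) :
  prime_order_class_reps G P ->
  g \in G -> v \in X -> diag_mul g v = v -> g = 1%g.
Proof.
move=> [_ conjP] Gg; rewrite inE => /forallP Xv fix_v; apply/eqP/idPn=> ntg.
have fixX n : diag_mul (g ^+ n)%g v = v.
  by elim: n => [|n IHn]; rewrite ?diag_mul1 // expgS diag_mulM IHn.
have g_gt1 : (1 < #[g]%g)%N by rewrite order_gt1.
set p := pdiv #[g]%g; have p_pr : prime p by apply: pdiv_prime.
pose h := (g ^+ (#[g] %/ p))%g.
have oh : #[h]%g = p.
  by rewrite orderXdiv ?dvdn_div ?pdiv_dvd // divnA ?pdiv_dvd // mulKn.
have Gh : h \in G by apply: groupX.
have /(_ _ _)[||i [[a Ga Pi] _]] := conjP <[h]>%G; rewrite ?cycle_subG //.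
  by rewrite -orderE oh.
have /eqP : h = 1%g.
  apply: (coset_rep_free (Xv i) (g := a^-1)%g); first by rewrite groupV.
    by rewrite Pi conjsgK cycle_id.
  by have /ffunP/(_ i) := fixX (#[g]%g %/ p)%N; rewrite ffunE.
by rewrite -order_eq1 oh => /eqP p1; rewrite p1 in p_pr.
Qed.

(** For a free action, (h, j) |-> h w_j is a bijection from pairs onto X. *)
Lemma sum_free_orbit_reps (k : nmodType)
    (s : nat) (w : 'I_s -> {ffun 'I_m -> {set gT}})
    (F : {ffun 'I_m -> {set gT}} -> k) :
  orbit_reps G X w ->
  (forall g v, g \in G -> v \in X -> diag_mul g v = v -> g = 1%g) ->
  \sum_(v in X) F v = \sum_(h in G) \sum_(j < s) F (diag_mul h (w j)).
Proof.
move=> [Xw repw] freeG; rewrite pair_big /=.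
have -> : X = [set diag_mul u.1 (w u.2) |
                u in [pred u : gT * 'I_s | (u.1 \in G) && true]].
  apply/setP=> v; apply/idP/imsetP=> [/repw[j [/imsetP[g Gg ->] _]] | [[g j]]].
    by exists (g, j); rewrite ?inE ?Gg.
  by rewrite inE andbT /= => Gg ->; apply: diag_mul_prod_rep_sets.
rewrite big_imset //= => -[g j] [h l]; rewrite !inE !andbT /= => Gg Gh eq_gh.
have [i [_ uniq_i]] := repw _ (diag_mul_prod_rep_sets Gg (Xw j)).
have eq_jl : j = l.
  have orb_l : diag_mul g (w j) \in diag_orbit G (w l).
    by rewrite eq_gh; apply: imset_f.
  by rewrite -(uniq_i l orb_l); apply/esym/uniq_i/imset_f.
rewrite -eq_jl in eq_gh *; congr (_, _).
apply/eqP; rewrite eq_sym eq_mulVg1; apply/eqP.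
apply: freeG (Xw j) _; first by rewrite groupM ?groupV.
by rewrite diag_mulM eq_gh -diag_mulM mulVg diag_mul1.
Qed.

Variables (k : comPzRingType) (rho : gT -> {rmorphism k -> k}).
Hypothesis hrho : is_ring_action G rho.
Variable x : 'I_m -> k.

Lemma weight_diag_mul (h : gT) (v : {ffun 'I_m -> {set gT}}) :
  h \in G -> v \in X ->
  \prod_i \prod_(g in diag_mul h v i) rho g (x i) =
  rho h (\prod_i \prod_(g in v i) rho g (x i)).
Proof.
move=> Gh; rewrite inE => /forallP Xv; rewrite rmorph_prod.
apply: eq_bigr => i _; rewrite ffunE -lcosetE big_imset /=; last first.
  by move=> ? ? _ _; apply: mulgI.
rewrite rmorph_prod; apply: eq_bigr => g vg.
have := Xv i; rewrite inE => /and3P[sviG _ _].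
by case: hrho => _ -> //; apply: (subsetP sviG).
Qed.

Lemma sum_prod_rep_sets :
  (forall i, tr rho (P i) (x i) = 1) ->
  \sum_(v in X) \prod_i \prod_(g in v i) rho g (x i) = 1.
Proof.
move=> trx.
rewrite (eq_bigl (family (fun i => [in coset_rep_sets G (P i)]))).
  have <- := bigA_distr_big_dep (fun i => [in coset_rep_sets G (P i)])
    (fun i A => \prod_(g in A) rho g (x i)).
  by apply: big1 => i _; apply: sum_coset_reps.
by move=> v; rewrite inE; apply: eq_forallb => i.
Qed.

End Translation.

Theorem proposition1p1 (gT : finGroupType) (G : {group gT})
    (k : comPzRingType) (rho : gT -> {rmorphism k -> k})
    (hrho : is_ring_action G rho)
    (m : nat) (P : 'I_m -> {group gT}) (hP : prime_order_class_reps G P)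
    (s : nat) (w : 'I_s -> {ffun 'I_m -> {set gT}})
    (hw : orbit_reps G (prod_rep_sets G P) w)
    (x : 'I_m -> k) (hx : forall i : 'I_m, tr rho (P i) (x i) = 1) :
  tr rho G (\sum_(j < s) \prod_(i < m) \prod_(g in w j i) rho g (x i)) = 1.
Proof.
have sPG i : P i \subset G by case: hP => /(_ i)[].
rewrite -[RHS](sum_prod_rep_sets sPG hrho hx) (sum_free_orbit_reps _ hw);
  last first.
  by move=> g v Gg Xv; apply: prod_rep_sets_free hP Gg Xv.
rewrite /tr; apply: eq_bigr => h Gh; rewrite rmorph_sum.
apply: eq_bigr => j _; rewrite (weight_diag_mul (P := P) hrho x Gh) //.
by case: hw => Xw _; apply: Xw.
Qed.
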